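(* Let $M$ be a finite-dimensional free $\mathbb{T}$-module, let $P_1$ and $P_2$ be the projections defined with respect to a basis $\{|m_l\rangle\}$ of $M$, and let $V$ be the $\mathbb{C}(\mathbf{i_1})$-vector space associated with $\{|m_l\rangle\}$. If $\{|s_l\rangle\}$ is another basis of $M$, then $\{P_1(|s_l\rangle)\}$ and $\{P_2(|s_l\rangle)\}$ are bases of $V$.
   Context: Bicomplex numbers: $\mathbb{T}$ is the commutative ring of elements $w=z_1+z_2\mathbf{i_2}$ with $z_1,z_2\in\mathbb{C}(\mathbf{i_1})=\{x+y\mathbf{i_1}: x,y\in\mathbb{R}\}$ (a copy of the complex field), where $\mathbf{i_1}^2=\mathbf{i_2}^2=-1$ and $\mathbf{i_1}\mathbf{i_2}=\mathbf{i_2}\mathbf{i_1}=\mathbf{j}$, so $\mathbf{j}^2=1$. Put $\mathbf{e_1}=(1+\mathbf{j})/2$, $\mathbf{e_2}=(1-\mathbf{j})/2$; then $\mathbf{e_k}^2=\mathbf{e_k}$, $\mathbf{e_1}\mathbf{e_2}=0$, $\mathbf{e_1}+\mathbf{e_2}=1$, and every $w\in\mathbb{T}$ is uniquely $w=\mathbf{e_1}w_{\hat 1}+\mathbf{e_2}w_{\hat 2}$ with $w_{\hat 1},w_{\hat 2}\in\mathbb{C}(\mathbf{i_1})$. A finite-dimensional free $\mathbb{T}$-module is a $\mathbb{T}$-module with a finite basis (linearly independent generating set). Given a basis $\{|m_l\rangle\}_{l=1}^n$ of $M$, the associated vector space is $V=\{\sum_{l=1}^n x_l|m_l\rangle: x_l\in\mathbb{C}(\mathbf{i_1})\}$,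 a vector space over $\mathbb{C}(\mathbf{i_1})$. Every $|\psi\rangle\in M$ decomposes uniquely as $|\psi\rangle=\mathbf{e_1}|\psi\rangle_{\hat 1}+\mathbf{e_2}|\psi\rangle_{\hat 2}$ with $|\psi\rangle_{\hat k}\in V$, and $P_k:M\to V$ is defined by $P_k(|\psi\rangle)=|\psi\rangle_{\hat k}$. *)

(* Defs.v *)
From HB Require Import structures.
From mathcomp Require Import all_boot all_order all_algebra.
From mathcomp Require Import boolp classical_sets reals.
From mathcomp Require Import complex.
From mathcomp Require Import ring.

Set Implicit Arguments.
Unset Strict Implicit.
Unset Printing Implicit Defensive.

Import Order.TTheory GRing.Theory Num.Theory.

Local Open Scope ring_scope.

(* [Bicomplex z1 z2] is z1 + z2 i2; C(i1) is R[i], with i1 = 'i%C. *)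
Record bicomplex (R : realType) : Type :=
  Bicomplex { bc1 : R[i]; bc2 : R[i] }.

Section BicomplexRing.
Variable R : realType.
Local Notation T := (bicomplex R).

Definition bc_pair (w : T) : R[i] * R[i] := (bc1 w, bc2 w).
Definition pair_bc (p : R[i] * R[i]) : T := Bicomplex p.1 p.2.

Lemma bc_pairK : cancel bc_pair pair_bc.
Proof. by case. Qed.

HB.instance Definition _ := Choice.copy T (can_type bc_pairK).

Definition addbc (w v : T) : T := Bicomplex (bc1 w + bc1 v) (bc2 w + bc2 v).
Definition oppbc (w : T) : T := Bicomplex (- bc1 w) (- bc2 w).
Definition zerobc : T := Bicomplex 0 0.
Definition onebc : T := Bicomplex 1 0.
Definition mulbc (w v : T) : T :=
  Bicomplex (bc1 w * bc1 v - bc2 w * bc2 v) (bc1 w * bc2 v + bc2 w * bc1 v).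

Lemma bc_eq (w v : T) : bc1 w = bc1 v -> bc2 w = bc2 v -> w = v.
Proof. by case: w v => [? ?] [? ?] /= -> ->. Qed.

Lemma addbcA : associative addbc.
Proof. by move=> u v w; apply: bc_eq; rewrite /= addrA. Qed.

Lemma addbcC : commutative addbc.
Proof. by move=> u v; apply: bc_eq; rewrite /= addrC. Qed.

Lemma add0bc : left_id zerobc addbc.
Proof. by move=> u; apply: bc_eq; rewrite /= add0r. Qed.

Lemma addNbc : left_inverse zerobc oppbc addbc.
Proof. by move=> u; apply: bc_eq; rewrite /= addNr. Qed.

HB.instance Definition _ :=
  GRing.isZmodule.Build T addbcA addbcC add0bc addNbc.

Lemma mulbcA : associative mulbc.
Proof. by move=> u v w; apply: bc_eq => /=; ring. Qed.

Lemma mulbcC : commutative mulbc.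
Proof. by move=> u v; apply: bc_eq => /=; ring. Qed.

Lemma mul1bc : left_id onebc mulbc.
Proof. by move=> u; apply: bc_eq => /=; ring. Qed.

Lemma mulbcDl : left_distributive mulbc +%R.
Proof. by move=> u v w; apply: bc_eq => /=; ring. Qed.

Lemma onebc_neq0 : onebc != 0.
Proof. by apply/eqP => -[] /eqP; rewrite oner_eq0. Qed.

HB.instance Definition _ :=
  GRing.Zmodule_isComNzRing.Build T mulbcA mulbcC mul1bc mulbcDl onebc_neq0.

Definition bcC (z : R[i]) : T := Bicomplex z 0.

Lemma bcC_is_zmod_morphism : zmod_morphism bcC.
Proof. by move=> x y; apply: bc_eq; rewrite //= subr0. Qed.

Lemma bcC_is_monoid_morphism : monoid_morphism bcC.
Proof. by split=> // x y; apply: bc_eq => /=; ring. Qed.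

HB.instance Definition _ :=
  GRing.isZmodMorphism.Build R[i] T bcC bcC_is_zmod_morphism.
HB.instance Definition _ :=
  GRing.isMonoidMorphism.Build R[i] T bcC bcC_is_monoid_morphism.

Definition i1 : T := bcC 'i%C.
Definition i2 : T := Bicomplex 0 1.
Definition bcj : T := i1 * i2.
Definition e1 : T := bcC 2^-1 * (1 + bcj).
Definition e2 : T := bcC 2^-1 * (1 - bcj).

Lemma bicomplexE (w : T) : w = bcC (bc1 w) + bcC (bc2 w) * i2.
Proof. by apply: bc_eq => /=; ring. Qed.

Lemma mul_i1i1 : i1 * i1 = -1.
Proof. by rewrite -rmorphM -expr2 sqr_i rmorphN1. Qed.

Lemma mul_i2i2 : i2 * i2 = -1.
Proof. by apply: bc_eq => /=; ring. Qed.

Lemma e1E : e1 = Bicomplex 2^-1 (2^-1 * 'i%C).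
Proof. by apply: bc_eq => /=; ring. Qed.

Lemma e2E : e2 = Bicomplex 2^-1 (- (2^-1 * 'i%C)).
Proof. by apply: bc_eq => /=; ring. Qed.

Lemma add_e1e2 : e1 + e2 = 1.
Proof. by rewrite e1E e2E; apply: bc_eq => /=; field. Qed.

Let mulii : 'i%C * 'i%C = -1 :> R[i].
Proof. by rewrite -expr2 sqr_i. Qed.

Lemma mul_e1e2 : e1 * e2 = 0.
Proof.
rewrite e1E e2E; apply: bc_eq => /=; last by ring.
have -> : 2^-1 * 2^-1 - 2^-1 * 'i%C * - (2^-1 * 'i%C)
  = 2^-1 * 2^-1 * (1 + 'i%C * 'i%C) :> R[i] by ring.
by rewrite mulii subrr mulr0.
Qed.

Lemma mul_e1e1 : e1 * e1 = e1.
Proof. by rewrite -[RHS]mulr1 -add_e1e2 mulrDr mul_e1e2 addr0. Qed.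

Lemma mul_e2e2 : e2 * e2 = e2.
Proof. by rewrite -[RHS]mulr1 -add_e1e2 mulrDr [e2 * e1]mulrC mul_e1e2 add0r. Qed.

Lemma bc_idemE (w : T) :
  w = e1 * bcC (bc1 w - bc2 w * 'i%C) + e2 * bcC (bc1 w + bc2 w * 'i%C).
Proof.
rewrite e1E e2E; apply: bc_eq => /=; first by field.
set a := bc1 w; set b := bc2 w.
transitivity (- (b * ('i%C * 'i%C))); last by field.
by rewrite mulii mulrN1 opprK.
Qed.

Lemma bc_idem_inj (x y : R[i]) : e1 * bcC x + e2 * bcC y = 0 -> x = 0 /\ y = 0.
Proof.
have half : 2^-1 != 0 :> R[i] by rewrite invr_eq0 pnatr_eq0.
have e1C z : e1 * bcC z = 0 -> z = 0.
  rewrite e1E => /(congr1 (@bc1 R)) /= /eqP.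
  by rewrite mulr0 subr0 mulf_eq0 (negPf half) => /eqP.
have e2C z : e2 * bcC z = 0 -> z = 0.
  rewrite e2E => /(congr1 (@bc1 R)) /= /eqP.
  by rewrite mulr0 subr0 mulf_eq0 (negPf half) => /eqP.
move=> H; split; [apply: e1C|apply: e2C].
- have := congr1 ( *%R e1) H.
  by rewrite mulrDr (mulrA e1 e1) (mulrA e1 e2) mul_e1e1 mul_e1e2 mul0r addr0 mulr0.
- have := congr1 ( *%R e2) H.
  by rewrite mulrDr (mulrA e2 e1) (mulrA e2 e2) mul_e2e2 (mulrC e2 e1) mul_e1e2 mul0r add0r mulr0.
Qed.

End BicomplexRing.

Arguments i1 {R}.
Arguments i2 {R}.
Arguments bcj {R}.
Arguments e1 {R}.
Arguments e2 {R}.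

Definition lin_indep (A : nzRingType) (N : lmodType A) (n : nat)
    (b : 'I_n -> N) : Prop :=
  forall x : 'I_n -> A, \sum_l x l *: b l = 0 -> forall l, x l = 0.

Definition generating (A : nzRingType) (N : lmodType A) (n : nat)
    (b : 'I_n -> N) : Prop :=
  forall v : N, exists x : 'I_n -> A, v = \sum_l x l *: b l.

Definition is_basis (A : nzRingType) (N : lmodType A) (n : nat)
    (b : 'I_n -> N) : Prop :=
  lin_indep b /\ generating b.

Section AssociatedSpace.
Variables (R : realType) (M : lmodType (bicomplex R)) (n : nat) (m : 'I_n -> M).

Definition in_assoc : {pred M} :=
  fun v => `[< exists x : 'I_n -> R[i], v = \sum_l bcC (x l) *: m l >].

Lemma in_assocP v :
  reflect (exists x : 'I_n -> R[i], v = \sum_l bcC (x l) *: m l)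
          (v \in in_assoc).
Proof. exact: asboolP. Qed.

Lemma in_assoc_zmod : zmod_closed in_assoc.
Proof.
split.
  apply/in_assocP; exists (fun=> 0).
  by rewrite big1// => l _; rewrite rmorph0 scale0r.
move=> u v /in_assocP[x ->] /in_assocP[y ->]; apply/in_assocP.
exists (fun l => x l - y l).
by rewrite -sumrB; apply: eq_bigr => l _; rewrite rmorphB scalerBl.
Qed.

HB.instance Definition _ := GRing.isZmodClosed.Build M in_assoc in_assoc_zmod.

Record assoc_space : Type :=
  AssocSpace { assoc_val : M; assoc_valP : assoc_val \in in_assoc }.

HB.instance Definition _ := [isSub for assoc_val].
HB.instance Definition _ := [Choice of assoc_space by <:].
HB.instance Definition _ := [SubChoice_isSubZmodule of assoc_space by <:].

Lemma in_assoc_scale (a : R[i]) (v : M) :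
  v \in in_assoc -> bcC a *: v \in in_assoc.
Proof.
move=> /in_assocP[x ->]; apply/in_assocP; exists (fun l => a * x l).
by rewrite scaler_sumr; apply: eq_bigr => l _; rewrite scalerA rmorphM.
Qed.

Definition assoc_scale (a : R[i]) (v : assoc_space) : assoc_space :=
  AssocSpace (in_assoc_scale a (assoc_valP v)).

Lemma assoc_scaleA a b v :
  assoc_scale a (assoc_scale b v) = assoc_scale (a * b) v.
Proof. by apply: val_inj; rewrite /= scalerA rmorphM. Qed.

Lemma assoc_scale1 : left_id 1 assoc_scale.
Proof. by move=> v; apply: val_inj; rewrite /= rmorph1 scale1r. Qed.

Lemma assoc_scaleDr : right_distributive assoc_scale +%R.
Proof. by move=> a u v; apply: val_inj; rewrite /= scalerDr. Qed.

Lemma assoc_scaleDl v : {morph assoc_scale^~ v : a b / a + b}.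
Proof. by move=> a b; apply: val_inj; rewrite /= rmorphD scalerDl. Qed.

HB.instance Definition _ := GRing.Zmodule_isLmodule.Build R[i] assoc_space
  assoc_scaleA assoc_scale1 assoc_scaleDr assoc_scaleDl.

Definition idem_decomp (psi : M) : set (assoc_space * assoc_space) :=
  [set p : assoc_space * assoc_space |
     psi = e1 *: assoc_val p.1 + e2 *: assoc_val p.2]%classic.

(* When [m] is a basis this is the unique decomposition of [psi]
   ([P1P2E] and [P1P2_unique]); (0, 0) is a junk value otherwise. *)
Definition idem_pair (psi : M) : assoc_space * assoc_space :=
  xget (0, 0) (idem_decomp psi).

Definition P1 (psi : M) : assoc_space := (idem_pair psi).1.
Definition P2 (psi : M) : assoc_space := (idem_pair psi).2.

Lemma P1P2E (psi : M) : is_basis m ->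
  psi = e1 *: assoc_val (P1 psi) + e2 *: assoc_val (P2 psi).
Proof.
move=> [_ gen]; have [w psiE] := gen psi.
suff: exists p, idem_decomp psi p by exact: xgetPex.
pose f x : assoc_space :=
  AssocSpace (introT (in_assocP _) (ex_intro _ x (erefl _))).
exists (f (fun l => bc1 (w l) - bc2 (w l) * 'i%C),
        f (fun l => bc1 (w l) + bc2 (w l) * 'i%C)) => /=.
rewrite /idem_decomp /= !scaler_sumr -big_split psiE.
by apply: eq_bigr => l _; rewrite /= !scalerA -scalerDl -bc_idemE.
Qed.

Lemma P1P2_unique (psi : M) (u v : assoc_space) : is_basis m ->
  psi = e1 *: assoc_val u + e2 *: assoc_val v -> u = P1 psi /\ v = P2 psi.
Proof.
move=> mB psiE; have := P1P2E psi mB; case: (mB) => ind _.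
move: (P1 psi) (P2 psi) => u' v'; rewrite psiE => /eqP.
rewrite -subr_eq0 opprD addrACA -!scalerBr.
have /in_assocP[x xE] : assoc_val u - assoc_val u' \in in_assoc.
  by apply: rpredB; exact: assoc_valP.
have /in_assocP[y yE] : assoc_val v - assoc_val v' \in in_assoc.
  by apply: rpredB; exact: assoc_valP.
rewrite xE yE !scaler_sumr -big_split => /eqP xy0.
have {}xy0 l : x l = 0 /\ y l = 0.
  apply: bc_idem_inj; apply: (ind (fun l => e1 * bcC (x l) + e2 * bcC (y l))).
  rewrite -[RHS]xy0; apply: eq_bigr => k _.
  by rewrite /= !scalerA -scalerDl.
split; apply: val_inj => /=; apply/eqP; rewrite -subr_eq0.
- by rewrite xE big1// => l _; rewrite (xy0 l).1 rmorph0 scale0r.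
- by rewrite yE big1// => l _; rewrite (xy0 l).2 rmorph0 scale0r.
Qed.

End AssociatedSpace.

(* Main.v *)
Require Import Defs.
From mathcomp Require Import all_boot all_order all_algebra reals complex.

Import GRing.Theory.

Local Open Scope ring_scope.

(** Multiplication by [e1] (resp. [e2]) is injective on V, identifies [psi] with
    [P1 psi] (resp. [P2 psi]), and makes every bicomplex scalar act as a complex
    one. Hence a linear relation over C(i1) between the [P1 (s l)] is the
    [e1]-multiple of a relation between the [s l], and the [e1]-multiple of an
    expansion of [v] in V over the [s l] is the [e1]-multiple of an expansion of
    [v] over the [P1 (s l)]. *)

Section IdempotentComponents.
Variable R : realType.

(** Since [e1 * e2 = 0] and [e1] is idempotent, only the first idempotent coefficient of [w]
    survives. *)
Lemma mul_e1_complex (w : bicomplex R) :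
  e1 * w = e1 * bcC (bc1 w - bc2 w * 'i%C).
Proof.
by rewrite [in LHS](bc_idemE w) mulrDr (mulrA e1 e1) (mulrA e1 e2)
           mul_e1e1 mul_e1e2 mul0r addr0.
Qed.

Lemma mul_e2_complex (w : bicomplex R) :
  e2 * w = e2 * bcC (bc1 w + bc2 w * 'i%C).
Proof.
by rewrite [in LHS](bc_idemE w) mulrDr (mulrA e2 e1) (mulrA e2 e2)
           [e2 * e1]mulrC mul_e1e2 mul_e2e2 mul0r add0r.
Qed.

Lemma mul_e1_bcC_eq0 (x : R[i]) : e1 * bcC x = 0 -> x = 0.
Proof.
by move=> x0; apply: (@bc_idem_inj _ x 0 _).1; rewrite x0 rmorph0 mulr0 addr0.
Qed.

Lemma mul_e2_bcC_eq0 (x : R[i]) : e2 * bcC x = 0 -> x = 0.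
Proof.
by move=> x0; apply: (@bc_idem_inj _ 0 x _).2; rewrite x0 rmorph0 mulr0 addr0.
Qed.

Variables (M : lmodType (bicomplex R)) (n : nat) (m : 'I_n -> M).

Lemma assoc_val_comb k (x : 'I_k -> R[i]) (v : 'I_k -> assoc_space m) :
  assoc_val (\sum_l x l *: v l) = \sum_l bcC (x l) *: assoc_val (v l).
Proof. exact: (raddf_sum (\val : assoc_space m -> M)). Qed.

(** One argument for both components: [e] stands for [e1] or [e2], and [P] for the matching
    projection. *)
Lemma basis_component (e : bicomplex R) (P : M -> assoc_space m)
    k (s : 'I_k -> M) :
  (forall w, exists x, e * w = e * bcC x) ->
  (forall x, e * bcC x = 0 -> x = 0) ->
  (forall v : assoc_space m, e *: assoc_val v = 0 -> v = 0) ->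
  (forall psi, e *: psi = e *: assoc_val (P psi)) ->
  is_basis s -> is_basis (fun l => P (s l)).
Proof.
move=> eC eC0 eV0 eP [ind gen].
(* Scalars commute, so [e] can be moved onto each [P (s l)], where it absorbs [P]. *)
have e_comb (x : 'I_k -> R[i]) :
    e *: assoc_val (\sum_l x l *: P (s l)) = \sum_l (e * bcC (x l)) *: s l.
  rewrite assoc_val_comb scaler_sumr; apply: eq_bigr => l _.
  by rewrite scalerA mulrC -scalerA -eP scalerA mulrC.
split=> [x x0 l|v].
  (* Independence of [s] kills the bicomplex coefficients [e * bcC (x l)]; then [e] cancels because
     [x l] is complex. *)
  apply: eC0; apply: (ind (fun l => e * bcC (x l))).
  by rewrite -e_comb x0 scaler0.
have [w vE] := gen (assoc_val v).
(* The complex [x l] agree with the bicomplex [w l] up to the factor [e]; they are the coordinates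
   of [v] over the [P (s l)]. *)
have [x xE] := boolp.choice (fun l => eC (w l)).
exists x; apply/eqP; rewrite -subr_eq0; apply/eqP/eV0.
have -> (u : assoc_space m) : assoc_val (v - u) = assoc_val v - assoc_val u.
  by [].
rewrite scalerBr e_comb vE scaler_sumr -sumrB big1// => l _.
by rewrite scalerA xE subrr.
Qed.

Hypothesis hm : is_basis m.

Lemma scale_e1_P1 (psi : M) : e1 *: psi = e1 *: assoc_val (P1 m psi).
Proof.
by rewrite {1}(P1P2E psi hm) scalerDr !scalerA mul_e1e1 mul_e1e2 scale0r addr0.
Qed.

Lemma scale_e2_P2 (psi : M) : e2 *: psi = e2 *: assoc_val (P2 m psi).
Proof.
by rewrite {1}(P1P2E psi hm) scalerDr !scalerA [e2 * e1]mulrC mul_e1e2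
           mul_e2e2 scale0r add0r.
Qed.

(** Both [(u, v)] and [(0, 0)] decompose the zero vector, so uniqueness identifies them. *)
Lemma idem_decomp_eq0 (u v : assoc_space m) :
  e1 *: assoc_val u + e2 *: assoc_val v = 0 -> u = 0 /\ v = 0.
Proof.
move=> uv0; have [-> ->] := P1P2_unique hm (esym uv0).
have [|<- <-//] := @P1P2_unique _ _ _ _ 0 0 0 hm.
by rewrite !scaler0 addr0.
Qed.

Lemma scale_e1_assoc_eq0 (v : assoc_space m) : e1 *: assoc_val v = 0 -> v = 0.
Proof.
by move=> v0; apply: (@idem_decomp_eq0 v 0 _).1; rewrite v0 scaler0 addr0.
Qed.

Lemma scale_e2_assoc_eq0 (v : assoc_space m) : e2 *: assoc_val v = 0 -> v = 0.
Proof.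
by move=> v0; apply: (@idem_decomp_eq0 0 v _).2; rewrite v0 scaler0 addr0.
Qed.

End IdempotentComponents.

Theorem theorem3p8 (R : realType) (M : lmodType (bicomplex R))
  (n : nat) (m : 'I_n -> M) (hm : is_basis m)
  (k : nat) (s : 'I_k -> M) (hs : is_basis s) :
  @is_basis R[i] (assoc_space m) k (fun l : 'I_k => P1 m (s l)) /\
  @is_basis R[i] (assoc_space m) k (fun l : 'I_k => P2 m (s l)).
Proof.
split.
- apply: (@basis_component _ _ _ _ e1) hs.
  + by move=> w; exists (bc1 w - bc2 w * 'i%C); exact: mul_e1_complex.
  + exact: mul_e1_bcC_eq0.
  + exact: scale_e1_assoc_eq0.
  + exact: scale_e1_P1.
- apply: (@basis_component _ _ _ _ e2) hs.
  + by move=> w; exists (bc1 w + bc2 w * 'i%C); exact: mul_e2_complex.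
  + exact: mul_e2_bcC_eq0.
  + exact: scale_e2_assoc_eq0.
  + exact: scale_e2_P2.
Qed.
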